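(* Let $\mathfrak{A}=\bigoplus_{i,j\in\mathbb{N}}\mathfrak{A}_{i,-j}$ be a Peirce algebra, let $\mathsf{A}=\mathfrak{A}_{0,0}$, and let $d\in\mathbb{N}$. Suppose that $\mathfrak{A}_d$ is strongly unital, that $\mathsf{Z}_d$ is unital (as a ring), and that $\mathsf{A}$ has no nontrivial idempotent ideals. Then there is an equivalence of categories between $\mathfrak{A}_d$-modules and $\mathsf{A}$-modules.
   Context: All algebras are associative but not necessarily commutative or unital; ideals are regarded as rings; modules are left modules, and modules over a unital ring are assumed unital. $\mathbb{N}=\mathbb{Z}_{\ge 0}$. A Peirce algebra is a (not necessarily unital) algebra $\mathfrak{A}$ over a commutative ring $R$, with product denoted $\star$, together with an $R$-module bigrading $\mathfrak{A}=\bigoplus_{i,j\in\mathbb{N}}\mathfrak{A}_{i,-j}$ such that: (1) $\mathfrak{A}_{i,-j}\star\mathfrak{A}_{k,-\ell}\subseteq\delta_{j,k}\mathfrak{A}_{i,-\ell}$; (2) $\mathsf{A}:=\mathfrak{A}_{0,0}$ is a unital subalgebra (that is, a subalgebra having its own identity element); (3) the product makes $\mathfrak{A}_{i,0}$ a unital right $\mathsf{A}$-module and $\mathfrak{A}_{0,-j}$ a unital left $\mathsf{A}$-module; (4) the product induces an isomorphism $\mathfrak{A}_{d,0}\otimes_{\mathsf{A}}\mathfrak{A}_{0,-d}\cong\mathfrak{A}_{d,-d}$ for every $d$. The subalgebra $\mathfrak{A}_d:=\mathfrak{A}_{d,-d}$ is strongly unital if there is an element $1_d\in\mathfrak{A}_d$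 that acts as the identity on the right on $\mathfrak{A}_{0,-d}$ and as the identity on the left on $\mathfrak{A}_{d,0}$, i.e. $x\star 1_d=x$ for all $x\in\mathfrak{A}_{0,-d}$ and $1_d\star y=y$ for all $y\in\mathfrak{A}_{d,0}$. Set $\mathcal{Z}_d:=\mathfrak{A}_{0,-d}\otimes_{\mathfrak{A}_d}\mathfrak{A}_{d,0}$ (the quotient of the tensor product over $R$ by the relations $x\star a\otimes y=x\otimes a\star y$ for $a\in\mathfrak{A}_d$). Then $\mathsf{Z}_d$ denotes the image of the map $\mathcal{Z}_d\to\mathsf{A}$, $x\otimes y\mapsto x\star y$; it is a two-sided ideal of $\mathsf{A}$. An ideal $I$ is idempotent if $I^2=I$; ''no nontrivial idempotent ideals'' means that the only idempotent two-sided ideals of $\mathsf{A}$ are $0$ and $\mathsf{A}$.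
   Formalization: ''Z_d is unital'' is read as excluding the zero ring when A is nonzero: Z_d is assumed nonzero unless A = 0. Otherwise the claim fails, e.g. A a field, all other components zero, d = 1, where A_d = Z_d = 0. *)

(* Defs.v *)
From HB Require Import structures.
From mathcomp Require Import all_boot all_order all_algebra.
From mathcomp Require Import boolp classical_sets.
From mathcomp.multinomials Require Import freeg.

Set Implicit Arguments.
Unset Strict Implicit.
Unset Printing Implicit Defensive.

Import GRing.Theory.
Local Open Scope ring_scope.

Record category := Category {
  obj :> Type;
  hom : obj -> obj -> Type;
  idm : forall x, hom x x;
  compm : forall x y z, hom y z -> hom x y -> hom x z;
  compm1 : forall x y (f : hom x y), compm f (idm x) = f;
  comp1m : forall x y (f : hom x y), compm (idm y) f = f;
  compmA : forall x y z t (h : hom z t) (g : hom y z) (f : hom x y),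
    compm h (compm g f) = compm (compm h g) f }.

Record functor (C D : category) := Functor {
  fobj :> C -> D;
  fmap : forall x y, hom x y -> hom (fobj x) (fobj y);
  fmap1 : forall x, fmap (idm x) = idm (fobj x);
  fmapM : forall x y z (g : hom y z) (f : hom x y),
    fmap (compm g f) = compm (fmap g) (fmap f) }.

Definition functor_id (C : category) : functor C C :=
  @Functor C C id (fun _ _ f => f) (fun _ => erefl) (fun _ _ _ _ _ => erefl).

Lemma functor_comp1 (C D E : category) (G : functor D E) (F : functor C D) x :
  fmap G (fmap F (idm x)) = idm (G (F x)).
Proof. by rewrite !fmap1. Qed.

Lemma functor_compM (C D E : category) (G : functor D E) (F : functor C D)
    x y z (g : hom y z) (f : hom x y) :
  fmap G (fmap F (compm g f)) = compm (fmap G (fmap F g)) (fmap G (fmap F f)).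
Proof. by rewrite !fmapM. Qed.

Definition functor_comp (C D E : category) (G : functor D E) (F : functor C D) :
    functor C E :=
  @Functor C E (fun x => G (F x)) (fun _ _ f => fmap G (fmap F f))
    (functor_comp1 G F) (@functor_compM _ _ _ G F).

Record nat_iso (C D : category) (F G : functor C D) := NatIso {
  eta : forall x, hom (F x) (G x);
  eta_inv : forall x, hom (G x) (F x);
  eta_natural : forall x y (f : hom x y),
    compm (eta y) (fmap F f) = compm (fmap G f) (eta x);
  etaK : forall x, compm (eta_inv x) (eta x) = idm (F x);
  eta_invK : forall x, compm (eta x) (eta_inv x) = idm (G x) }.

Definition equivalent_categories (C D : category) : Prop :=
  exists (F : functor C D) (G : functor D C),
    inhabited (nat_iso (functor_comp G F) (functor_id C)) /\
    inhabited (nat_iso (functor_comp F G) (functor_id D)).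

Section ModuleCategory.
Variable S : pzRingType.

Lemma linear_ext (M N : lmodType S) (f g : {linear M -> N}) : f =1 g -> f = g.
Proof.
move: f g => [f [[f1] [f2]]] [g [[g1] [g2]]] /= fg.
have {}fg : f = g by apply: funext.
subst g.
by rewrite (Prop_irrelevance f1 g1) (Prop_irrelevance f2 g2).
Qed.

Lemma linear_comp1 (M N : lmodType S) (f : {linear M -> N}) :
  (f \o idfun : {linear M -> N}) = f.
Proof. exact: linear_ext. Qed.

Lemma linear_1comp (M N : lmodType S) (f : {linear M -> N}) :
  (idfun \o f : {linear M -> N}) = f.
Proof. exact: linear_ext. Qed.

Lemma linear_compA (M N P Q : lmodType S)
    (h : {linear P -> Q}) (g : {linear N -> P}) (f : {linear M -> N}) :
  (h \o (g \o f) : {linear M -> Q}) = ((h \o g) \o f : {linear M -> Q}).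
Proof. exact: linear_ext. Qed.

Definition lmod_category : category :=
  @Category (lmodType S) (fun M N => {linear M -> N})
    (fun M => idfun) (fun M N P g f => g \o f)
    linear_comp1 linear_1comp linear_compA.

End ModuleCategory.

Section Ideals.
Variable A : pzRingType.
Implicit Types I : set A.
Local Open Scope classical_set_scope.

Definition two_sided_ideal I : Prop :=
  [/\ I 0, forall x y, I x -> I y -> I (x - y)
    & forall a x, I x -> I (a * x) /\ I (x * a)].

Definition ideal_sqr I : set A :=
  [set x | exists2 s : seq (A * A),
     forall p, p \in s -> I p.1 /\ I p.2 & x = \sum_(p <- s) p.1 * p.2].

Definition idempotent_ideal I : Prop := two_sided_ideal I /\ ideal_sqr I = I.

Definition no_nontrivial_idempotent_ideals : Prop :=
  forall I, idempotent_ideal I -> I = [set 0] \/ I = setT.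

(* The identity of I need not be the identity of A. *)
Definition unital_ideal I : Prop :=
  exists2 e, I e & forall x, I x -> e * x = x /\ x * e = x.

End Ideals.

Section TensorProduct.
Variables (R : pzRingType) (X Y : lmodType R) (S : Type).
Variables (actr : X -> S -> X) (actl : S -> Y -> Y).

(* The subgroup of the free abelian group on X * Y generated by the relations
   defining the tensor product over S (and over R). Only the additive group of
   the tensor product is built: R acts on it through either factor, and the
   additive map induced by an R-bilinear balanced map is R-linear. *)
Inductive tensor_rel : {freeg (X * Y)%type} -> Prop :=
| tensor_rel0 : tensor_rel 0
| tensor_relB u v : tensor_rel u -> tensor_rel v -> tensor_rel (u - v)
| tensor_relDl x x' y :
    tensor_rel (<< (x + x', y) >> - (<< (x, y) >> + << (x', y) >>))
| tensor_relDr x y y' :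
    tensor_rel (<< (x, y + y') >> - (<< (x, y) >> + << (x, y') >>))
| tensor_relZ a x y : tensor_rel (<< (a *: x, y) >> - << (x, a *: y) >>)
| tensor_relM x s y : tensor_rel (<< (actr x s, y) >> - << (x, actl s y) >>).

Definition tensor_relb : {pred {freeg (X * Y)%type}} :=
  fun u => `[< tensor_rel u >].

Lemma tensor_relb_closed : zmod_closed tensor_relb.
Proof.
split=> [|u v]; first exact/asboolP/tensor_rel0.
by move=> /asboolP u0 /asboolP v0; exact/asboolP/tensor_relB.
Qed.

HB.instance Definition _ :=
  GRing.isZmodClosed.Build {freeg (X * Y)%type} tensor_relb tensor_relb_closed.

Definition tensor : zmodType := Quotient.quot tensor_relb.

Definition tens (x : X) (y : Y) : tensor := \pi_tensor%qT << (x, y) >>.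

Definition free_lift (M : zmodType) (f : X -> Y -> M) :
    {freeg (X * Y)%type} -> M :=
  fglift (fun p : X * Y => f p.1 p.2 : zmodule M).

HB.instance Definition _ M f :=
  GRing.isZmodMorphism.Build {freeg (X * Y)%type} M (@free_lift M f)
    (@lift_is_additive int (X * Y)%type (zmodule M) _).

(* The additive map tensor -> M with tens x y |-> f x y, for f biadditive and
   balanced (tensor_lift_tens). *)
Definition tensor_lift (M : zmodType) (f : X -> Y -> M) (t : tensor) : M :=
  free_lift f (repr t).

Lemma pi_subr (u v : {freeg (X * Y)%type}) :
  \pi_tensor%qT (u - v) = \pi_tensor%qT u - \pi_tensor%qT v.
Proof. by rewrite !piE. Qed.

Section Lift.
Variables (M : zmodType) (f : X -> Y -> M).
Hypothesis fDl : forall x x' y, f (x + x') y = f x y + f x' y.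
Hypothesis fDr : forall x y y', f x (y + y') = f x y + f x y'.
Hypothesis fZ : forall a x y, f (a *: x) y = f x (a *: y).
Hypothesis fM : forall x s y, f (actr x s) y = f x (actl s y).

Local Notation F := (free_lift f).

Let F_rel u : tensor_rel u -> F u = 0.
Proof.
have FU x y : F << (x, y) >> = f x y by rewrite /free_lift liftU scale1r.
elim=> [|v w _ v0 _ w0|x x' y|x y y'|a x y|x s y].
- exact: raddf0.
- by rewrite raddfB /= v0 w0 subr0.
- by rewrite raddfB raddfD /= !FU fDl subrr.
- by rewrite raddfB raddfD /= !FU fDr subrr.
- by rewrite raddfB /= !FU fZ subrr.
- by rewrite raddfB /= !FU fM subrr.
Qed.

Let tensor_lift_pi u : tensor_lift f (\pi_tensor%qT u) = F u.
Proof.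
apply/eqP; rewrite -subr_eq0 /tensor_lift -raddfB; apply/eqP/F_rel.
apply/asboolP; rewrite -[`[< _ >]]/(_ \in tensor_relb) Quotient.idealrBE.
by rewrite reprK.
Qed.

Lemma tensor_lift_tens x y : tensor_lift f (tens x y) = f x y.
Proof. by rewrite /tens tensor_lift_pi /free_lift liftU scale1r. Qed.

Lemma tensor_liftB t u :
  tensor_lift f (t - u) = tensor_lift f t - tensor_lift f u.
Proof.
by rewrite -[t]reprK -[u]reprK -pi_subr !tensor_lift_pi raddfB.
Qed.

End Lift.

Lemma tensor_ind (P : tensor -> Prop) :
    P 0 -> (forall t u, P t -> P u -> P (t - u)) -> (forall x y, P (tens x y)) ->
  forall t, P t.
Proof.
move=> P0 PB Pt t; rewrite -[t]reprK.
have PN u : P u -> P (- u) by move=> Pu; rewrite -sub0r; apply: PB.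
have PD u v : P u -> P v -> P (u + v).
  by move=> Pu Pv; rewrite -[v]opprK; apply: PB => //; apply: PN.
rewrite -[repr t]freeg_sumE raddf_sum /=.
apply: big_ind => // -[x y] _ /=; rewrite -[coeff _ _]intz -freegU_mulz raddfMz.
case: (coeff _ _) => n /=.
  by elim: n => // n IH; rewrite -pmulrn mulrS; apply: PD => //; apply: Pt.
rewrite NegzE mulrNz; apply: PN.
by elim: n.+1 => // m IH; rewrite -pmulrn mulrS; apply: PD => //; apply: Pt.
Qed.

End TensorProduct.

Section Submodule.
Variables (R : pzRingType) (V : lmodType R) (W : submodClosed V).

Definition submod := {x : V | x \in W}.
HB.instance Definition _ := SubType.on submod.
HB.instance Definition _ := Choice.on submod.
HB.instance Definition _ := [SubChoice_isSubLmodule of submod by <:].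

End Submodule.

Record bigradedAlg (R : comPzRingType) := BigradedAlg {
  balg :> lmodType R;
  bmul : balg -> balg -> balg;
  bmul_linearl : forall y, linear (bmul^~ y);
  bmul_linearr : forall x, linear (bmul x);
  bmulA : associative bmul;
  (* bcomp i j is the component of bidegree (i, -j) *)
  bcomp : nat -> nat -> submodClosed balg;
  bcomp_span : forall x, exists n (f : nat -> nat -> balg),
    (forall i j, f i j \in bcomp i j) /\
    x = \sum_(i < n) \sum_(j < n) f i j;
  bcomp_direct : forall n (f : nat -> nat -> balg),
    (forall i j, f i j \in bcomp i j) ->
    \sum_(i < n) \sum_(j < n) f i j = 0 ->
    forall i j, (i < n)%N -> (j < n)%N -> f i j = 0;
  bcomp_mul : forall i j l x y,
    x \in bcomp i j -> y \in bcomp j l -> bmul x y \in bcomp i l;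
  bcomp_mul0 : forall i j k l x y, j != k ->
    x \in bcomp i j -> y \in bcomp k l -> bmul x y = 0 }.

Section Components.
Variables (R : comPzRingType) (P : bigradedAlg R).

Definition comp i j : lmodType R := submod (bcomp P i j).

Definition cmul i j l (x : comp i j) (y : comp j l) : comp i l :=
  exist _ (bmul (val x) (val y)) (bcomp_mul (valP x) (valP y)).

Lemma val_cmul i j l (x : comp i j) (y : comp j l) :
  val (cmul x y) = bmul (val x) (val y).
Proof. by []. Qed.

Lemma cmulDl i j l (x x' : comp i j) (y : comp j l) :
  cmul (x + x') y = cmul x y + cmul x' y.
Proof.
apply: val_inj; rewrite raddfD !val_cmul raddfD.
by have := bmul_linearl (val y) 1 (val x) (val x'); rewrite /= !scale1r.
Qed.

Lemma cmulDr i j l (x : comp i j) (y y' : comp j l) :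
  cmul x (y + y') = cmul x y + cmul x y'.
Proof.
apply: val_inj; rewrite raddfD !val_cmul raddfD.
by have := bmul_linearr (val x) 1 (val y) (val y'); rewrite /= !scale1r.
Qed.

Lemma bmul0l (y : P) : bmul 0 y = 0.
Proof.
by have /eqP := bmul_linearl y 1 0 0; rewrite !scale1r addr0
  -subr_eq subrr eq_sym => /eqP.
Qed.

Lemma bmul0r (x : P) : bmul x 0 = 0.
Proof.
by have /eqP := bmul_linearr x 1 0 0; rewrite !scale1r addr0
  -subr_eq subrr eq_sym => /eqP.
Qed.

Lemma cmulZ i j l a (x : comp i j) (y : comp j l) :
  cmul (a *: x) y = cmul x (a *: y).
Proof.
apply: val_inj; rewrite !val_cmul !linearZ /=.
have := bmul_linearl (val y) a (val x) 0; rewrite addr0 bmul0l addr0 => ->.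
by have := bmul_linearr (val x) a (val y) 0; rewrite addr0 bmul0r addr0 => ->.
Qed.

Lemma cmulA i j k l (x : comp i j) (y : comp j k) (z : comp k l) :
  cmul x (cmul y z) = cmul (cmul x y) z.
Proof. by apply: val_inj; rewrite !val_cmul bmulA. Qed.

(* comp i j (x) comp j k over the (possibly non-unital) algebra comp j j,
   with the map induced by the product. *)
Definition comp_tensor i j k : zmodType :=
  tensor (@cmul i j j) (@cmul j j k).

Definition comp_tensor_mul i j k : comp_tensor i j k -> comp i k :=
  tensor_lift (@cmul i j k).

Lemma comp_tensor_mul_tens i j k (x : comp i j) (y : comp j k) :
  comp_tensor_mul (tens (@cmul i j j) (@cmul j j k) x y) = cmul x y.
Proof.
apply: tensor_lift_tens => *;
  [exact: cmulDl|exact: cmulDr|exact: cmulZ|by rewrite cmulA].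
Qed.

Lemma comp_tensor_mulB i j k (t u : comp_tensor i j k) :
  comp_tensor_mul (t - u) = comp_tensor_mul t - comp_tensor_mul u.
Proof.
apply: tensor_liftB => *;
  [exact: cmulDl|exact: cmulDr|exact: cmulZ|by rewrite cmulA].
Qed.

End Components.

(* The identity element of comp 0 0 required of a Peirce algebra is pone: the
   two identity laws at i = j = 0. *)
Record peirceAlg (R : comPzRingType) := PeirceAlg {
  peirce_base :> bigradedAlg R;
  pone : comp peirce_base 0 0;
  cmul1 : forall i (x : comp peirce_base i 0), cmul x pone = x;
  cmul1l : forall j (y : comp peirce_base 0 j), cmul pone y = y;
  comp_tensor_iso : forall d, bijective (@comp_tensor_mul _ peirce_base d 0 d) }.

Section Rings.
Variables (R : comPzRingType) (P : peirceAlg R).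

Definition deg0_ring : Type := comp P 0 0.
HB.instance Definition _ := GRing.Zmodule.on deg0_ring.
HB.instance Definition _ := GRing.Zmodule_isPzRing.Build deg0_ring
  (@cmulA _ P 0 0 0 0) (@cmul1l _ P 0) (@cmul1 _ P 0)
  (@cmulDl _ P 0 0 0) (@cmulDr _ P 0 0 0).

(* Such an element sunit is unique, being an identity element of comp d d. *)
Record strongly_unital d := StronglyUnital {
  sunit : comp P d d;
  cmul_sunit : forall x : comp P 0 d, cmul x sunit = x;
  sunit_cmul : forall y : comp P d 0, cmul sunit y = y }.

Lemma comp_diag_ind d (Q : comp P d d -> Prop) :
    Q 0 -> (forall a b, Q a -> Q b -> Q (a - b)) ->
    (forall (x : comp P d 0) (y : comp P 0 d), Q (cmul x y)) ->
  forall a, Q a.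
Proof.
move=> Q0 QB QM a; have [g _ gK] := comp_tensor_iso P d.
rewrite -[a]gK; elim/tensor_ind: (g a) => [|s t IHs IHt|x y].
- by rewrite -[0]subr0 comp_tensor_mulB subrr.
- by rewrite comp_tensor_mulB; apply: QB.
- by rewrite comp_tensor_mul_tens.
Qed.

Section Diagonal.
Variables (d : nat) (hd : strongly_unital d).

Lemma sunit1l : left_id (sunit hd) (@cmul _ P d d d).
Proof.
elim/comp_diag_ind => [|a b IHa IHb|x y]; last by rewrite cmulA sunit_cmul.
- by apply: (addrI (cmul (sunit hd) 0)); rewrite -cmulDr !addr0.
- by apply: (addIr (cmul (sunit hd) b)); rewrite -cmulDr subrK IHa IHb subrK.
Qed.

Lemma sunit1r : right_id (sunit hd) (@cmul _ P d d d).
Proof.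
elim/comp_diag_ind => [|a b IHa IHb|x y]; last by rewrite -cmulA cmul_sunit.
- by apply: (addrI (cmul 0 (sunit hd))); rewrite -cmulDl !addr0.
- by apply: (addIr (cmul b (sunit hd))); rewrite -cmulDl subrK IHa IHb subrK.
Qed.

End Diagonal.

Definition diag_ring d (hd : strongly_unital d) : Type := comp P d d.
HB.instance Definition _ d (hd : strongly_unital d) :=
  GRing.Zmodule.on (diag_ring hd).
HB.instance Definition _ d (hd : strongly_unital d) :=
  GRing.Zmodule_isPzRing.Build (diag_ring hd)
    (@cmulA _ P d d d d) (sunit1l hd) (sunit1r hd)
    (@cmulDl _ P d d d) (@cmulDr _ P d d d).

Definition Zideal d : set deg0_ring := range (@comp_tensor_mul _ P 0 d 0).

Lemma Zideal_ideal d : two_sided_ideal (Zideal d).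
Proof.
have c0 : comp_tensor_mul (0 : comp_tensor P 0 d 0) = 0.
  by rewrite -[0]subr0 comp_tensor_mulB subrr.
split; first by exists 0.
  move=> _ _ [t _ <-] [u _ <-]; exists (t - u) => //; exact: comp_tensor_mulB.
have ZB x y : Zideal d x -> Zideal d y -> Zideal d (x - y).
  move=> [t _ <-] [u _ <-]; exists (t - u) => //; exact: comp_tensor_mulB.
move=> a _ [t _ <-]; elim/tensor_ind: t => [|t u [IHt IHt'] [IHu IHu']|x y].
- by rewrite c0 mulr0 mul0r; split; exists 0.
- by rewrite comp_tensor_mulB mulrBr mulrBl; split; apply: ZB.
- rewrite comp_tensor_mul_tens; split.
  + by exists (tens _ _ (cmul a x) y) => //; rewrite comp_tensor_mul_tens -cmulA.
  + by exists (tens _ _ x (cmul y a)) => //; rewrite comp_tensor_mul_tens cmulA.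
Qed.

End Rings.

Arguments Zideal {R} P d.

(* Main.v *)
From HB Require Import structures.
From mathcomp Require Import all_boot all_algebra.
From mathcomp Require Import boolp classical_sets functions.
Require Import Defs.
Import GRing.Theory.
Local Open Scope ring_scope.

(** Write 1 = \sum_k u_k v_k in A_d, with the u_k in A_(d,0) and the v_k in
    A_(0,-d); this is possible because the product maps the tensor product onto
    A_d. A unital ideal is idempotent, so Z_d is 0 or A, and the convention on
    zero rings leaves 1 = \sum_i x_i y_i in A with the x_i in A_(0,-d) and the
    y_i in A_(d,0). Hence A_(d,0) and A_(0,-d) form a Morita context with both
    pairings onto. The quasi-inverse functors are taken to be Hom(A_(d,0), -)
    and Hom(A_(0,-d), -), which avoids tensor products: for a module M over A_d,
    m |-> (x |-> y |-> (y x) m) has inverse g |-> \sum_k g(v_k)(u_k), and the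
    other composite is the same with the two sides exchanged. *)

Set Implicit Arguments.
Unset Strict Implicit.
Unset Printing Implicit Defensive.

(* The laws making the left action a module structure are omitted: only its
   compatibility with the right action matters for Hom(B, M). *)
Record bimodule (S T : pzRingType) := Bimodule {
  bim :> zmodType;
  lact : S -> bim -> bim;
  ract : bim -> T -> bim;
  ractDl : forall y y' t, ract (y + y') t = ract y t + ract y' t;
  ractDr : forall y t t', ract y (t + t') = ract y t + ract y t';
  ractA : forall y t t', ract y (t * t') = ract (ract y t) t';
  ract1 : forall y, ract y 1 = y;
  lractA : forall s y t, lact s (ract y t) = ract (lact s y) t }.

(** * The left [T]-module Hom_S(B, M) attached to a bimodule [B] *)

Section HomModule.
Variables (S T : pzRingType) (B : bimodule S T) (M : lmodType S).

(** Homs are cut out of the group of all functions, so their addition is inherited pointwise. *)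
Definition hom_pred : {pred B -> M} := fun f =>
  `[< (forall y y', f (y + y') = f y + f y') /\
      (forall s y, f (lact s y) = s *: f y) >].

Lemma hom_pred_closed : zmod_closed hom_pred.
Proof.
split=> [|f g /asboolP[fD fZ] /asboolP[gD gZ]]; apply/asboolP; split=> *.
- by rewrite addr0.
- by rewrite scaler0.
- by rewrite !fctE fD gD opprD addrACA.
- by rewrite !fctE fZ gZ scalerBr.
Qed.

HB.instance Definition _ :=
  GRing.isZmodClosed.Build (B -> M) hom_pred hom_pred_closed.

Definition hom_mod := {f : B -> M | f \in hom_pred}.
HB.instance Definition _ := SubType.on hom_mod.
HB.instance Definition _ := Choice.on hom_mod.
HB.instance Definition _ := [SubChoice_isSubZmodule of hom_mod by <:].

Definition hom_fun (f : hom_mod) : B -> M := val f.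
Coercion hom_fun : hom_mod >-> Funclass.

Lemma hom_ext (f g : hom_mod) : f =1 g -> f = g.
Proof. by move=> fg; apply/val_inj/funext. Qed.

Lemma homD (f : hom_mod) y y' : f (y + y') = f y + f y'.
Proof. by case/asboolP: (valP f) => + _; apply. Qed.

Lemma homZ (f : hom_mod) s y : f (lact s y) = s *: f y.
Proof. by case/asboolP: (valP f) => _; apply. Qed.

Lemma hom0 (f : hom_mod) : f 0 = 0.
Proof. by apply: (addrI (f 0)); rewrite -homD !addr0. Qed.

Lemma hom_sum (f : hom_mod) I (r : seq I) (F : I -> B) :
  f (\sum_(i <- r) F i) = \sum_(i <- r) f (F i).
Proof. exact: (big_morph f (homD f) (hom0 f)). Qed.

Lemma hom_addE (f g : hom_mod) y : hom_fun (f + g) y = f y + g y.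
Proof. by []. Qed.

Definition mk_hom (f : B -> M) (fD : forall y y', f (y + y') = f y + f y')
    (fZ : forall s y, f (lact s y) = s *: f y) : hom_mod :=
  exist _ f (asboolT (conj fD fZ)).

Lemma hom_scale_proofD t (f : hom_mod) y y' :
  f (ract (y + y') t) = f (ract y t) + f (ract y' t).
Proof. by rewrite ractDl homD. Qed.

Lemma hom_scale_proofZ t (f : hom_mod) s y :
  f (ract (lact s y) t) = s *: f (ract y t).
Proof. by rewrite -lractA homZ. Qed.

(** Precomposition with the right action of [T] on [B] is a left action on homs, because y(ab) =
    (ya)b. *)
Definition hom_scale t (f : hom_mod) : hom_mod :=
  mk_hom (hom_scale_proofD t f) (hom_scale_proofZ t f).

Lemma hom_scale_def t f y : hom_scale t f y = f (ract y t).
Proof. by []. Qed.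

Fact hom_scaleA a b f : hom_scale a (hom_scale b f) = hom_scale (a * b) f.
Proof. by apply: hom_ext => y; rewrite !hom_scale_def ractA. Qed.

Fact hom_scale1 : left_id 1 hom_scale.
Proof. by move=> f; apply: hom_ext => y; rewrite hom_scale_def ract1. Qed.

Fact hom_scaleDr : right_distributive hom_scale +%R.
Proof. by move=> a f g; apply: hom_ext. Qed.

Fact hom_scaleDl f : {morph hom_scale^~ f : a b / a + b}.
Proof.
by move=> a b; apply: hom_ext => y; rewrite hom_addE !hom_scale_def ractDr homD.
Qed.

HB.instance Definition _ := GRing.Zmodule_isLmodule.Build T hom_mod
  hom_scaleA hom_scale1 hom_scaleDr hom_scaleDl.

Lemma hom_scaleE t (f : hom_mod) y : hom_fun (t *: f) y = f (ract y t).
Proof. by []. Qed.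

End HomModule.

(** * Functoriality of Hom_S(B, -) *)

Section HomFunctor.
Variables (S T : pzRingType) (B : bimodule S T).

Section Map.
Variables (M N : lmodType S) (h : {linear M -> N}).

Lemma hom_map_proofD (f : hom_mod B M) y y' :
  h (f (y + y')) = h (f y) + h (f y').
Proof. by rewrite homD linearD. Qed.

Lemma hom_map_proofZ (f : hom_mod B M) s y : h (f (lact s y)) = s *: h (f y).
Proof. by rewrite homZ linearZ. Qed.

Definition hom_map (f : hom_mod B M) : hom_mod B N :=
  mk_hom (hom_map_proofD f) (hom_map_proofZ f).

Lemma hom_mapE f y : hom_map f y = h (f y).
Proof. by []. Qed.

Lemma hom_map_linear : linear hom_map.
Proof.
move=> t f g; apply: hom_ext => y.
by rewrite hom_addE hom_scaleE !hom_mapE hom_addE linearD.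
Qed.

HB.instance Definition _ :=
  GRing.isLinear.Build T (hom_mod B M) (hom_mod B N) *:%R hom_map
    hom_map_linear.
End Map.

Definition hom_functor : functor (lmod_category S) (lmod_category T).
Proof.
refine (@Functor (lmod_category S) (lmod_category T)
  (fun M => hom_mod B M) (fun M N h => hom_map h) _ _).
- by move=> M; apply: linear_ext => f; apply: hom_ext.
- by move=> M N K g f; apply: linear_ext => u; apply: hom_ext.
(* Kept transparent: the natural isomorphisms below need its values on objects and maps to
   compute. *)
Defined.

End HomFunctor.

(** * Morita contexts: writing 1 through a pairing inverts the coevaluation *)

Section Morita.
Variables (S T : pzRingType) (Y : bimodule S T) (X : bimodule T S).
Variables (yx : Y -> X -> S) (xy : X -> Y -> T).
Hypothesis yxDl : forall y y' x, yx (y + y') x = yx y x + yx y' x.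
Hypothesis yxDr : forall y x x', yx y (x + x') = yx y x + yx y x'.
Hypothesis yxZl : forall s y x, yx (lact s y) x = s * yx y x.
Hypothesis yxZr : forall y x s, yx y (ract x s) = yx y x * s.
Hypothesis yxM : forall y t x, yx y (lact t x) = yx (ract y t) x.
Hypothesis yxy : forall y x y', lact (yx y x) y' = ract y (xy x y').
Hypothesis xyx : forall x y x', lact (xy x y) x' = ract x (yx y x').

Section Unit.
Variable M : lmodType S.

Lemma coev_proofDl (m : M) x y y' : yx (y + y') x *: m = yx y x *: m + yx y' x *: m.
Proof. by rewrite yxDl scalerDl. Qed.

Lemma coev_proofZl (m : M) x s y : yx (lact s y) x *: m = s *: (yx y x *: m).
Proof. by rewrite yxZl scalerA. Qed.

Definition coev1 m x : hom_mod Y M :=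
  mk_hom (coev_proofDl m x) (coev_proofZl m x).

Lemma coev1E m x y : coev1 m x y = yx y x *: m.
Proof. by []. Qed.

Lemma coev_proofDr m x x' : coev1 m (x + x') = coev1 m x + coev1 m x'.
Proof. by apply: hom_ext => y; rewrite hom_addE !coev1E yxDr scalerDl. Qed.

Lemma coev_proofZr m t x : coev1 m (lact t x) = t *: coev1 m x.
Proof. by apply: hom_ext => y; rewrite hom_scaleE !coev1E yxM. Qed.

Definition coev m : hom_mod X (hom_mod Y M) :=
  mk_hom (coev_proofDr m) (coev_proofZr m).

Lemma coevE m x y : hom_fun (coev m x) y = yx y x *: m.
Proof. by []. Qed.

Lemma coev_linear : linear coev.
Proof.
move=> s m n; apply: hom_ext => x; apply: hom_ext => y.
by rewrite !(hom_addE, hom_scaleE) !coevE scalerDr scalerA yxZr.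
Qed.

HB.instance Definition _ :=
  GRing.isLinear.Build S M (hom_mod X (hom_mod Y M)) *:%R coev coev_linear.

Variable r : seq (Y * X).

(** The value depends on [r] in general, but no longer once [r] expresses 1: it is then the inverse
    of [coev]. *)
Definition ev (g : hom_mod X (hom_mod Y M)) : M :=
  \sum_(p <- r) hom_fun (g p.2) p.1.

Hypothesis r1 : \sum_(p <- r) yx p.1 p.2 = 1.

Lemma coevK : cancel coev ev.
Proof. by move=> m; rewrite /ev -scaler_suml r1 scale1r. Qed.

Lemma evK : cancel ev coev.
Proof.
move=> g; apply: hom_ext => x; apply: hom_ext => y.
(* On the right, x is expanded as the sum of the x(uv) over the pairs (u, v) of [r]. *)
rewrite coevE /ev scaler_sumr -[in RHS](ract1 x) -r1.
have -> : ract x (\sum_(p <- r) yx p.1 p.2) =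
          \sum_(p <- r) ract x (yx p.1 p.2).
  apply: (big_morph (ract x)); first exact: ractDr.
  by apply: (addrI (ract x 0)); rewrite -ractDr !addr0.
rewrite hom_sum.
rewrite (big_morph (fun f : hom_mod Y M => f y) (id1 := 0) (op1 := +%R)) //.
(* Both terms equal g(v)(y(xu)): on the left (yx)u = y(xu), on the right x(uv) = (xu)v and [g] is
   [T]-linear. *)
by apply: eq_bigr => p _; rewrite -homZ yxy -xyx homZ hom_scaleE.
Qed.

Lemma ev_linear : linear ev.
Proof. exact: (can2_linear coevK evK). Qed.

Definition ev_lin : {linear hom_mod X (hom_mod Y M) -> M} :=
  HB.pack ev (GRing.isLinear.Build _ _ _ _ ev ev_linear).

End Unit.

(** Covers one composite; exchanging [S] with [T] and [Y] with [X] gives the other. Naturality holds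
    because linear maps commute with the finite sum [ev]. *)
Lemma morita_nat_iso (r : seq (Y * X)) :
    \sum_(p <- r) yx p.1 p.2 = 1 ->
  nat_iso (functor_comp (hom_functor X) (hom_functor Y))
          (functor_id (lmod_category S)).
Proof.
move=> r1.
refine (@NatIso _ _ (functor_comp (hom_functor X) (hom_functor Y))
  (functor_id (lmod_category S)) (fun M => ev_lin M r1)
  (fun M => @coev M) _ _ _).
- by move=> M N f; apply: linear_ext => g; rewrite /= linear_sum.
- by move=> M; apply: linear_ext => g; apply: evK.
- by move=> M; apply: linear_ext => m; apply: coevK.
Qed.

End Morita.

(** If e is the identity of I, then x = ex lies in the square of I for every x in I. *)
Lemma unital_ideal_idempotent (A : pzRingType) (I : set A) :
  two_sided_ideal I -> unital_ideal I -> idempotent_ideal I.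
Proof.
move=> idI [e Ie eP]; split=> //; have [I0 IB IM] := idI.
apply/seteqP; split=> [_ [s sI ->]|x Ix] /=.
  have ID x y : I x -> I y -> I (x + y).
    by move=> Ix Iy; rewrite -[y]opprK -[- y]sub0r; apply/IB/IB.
  elim: s sI => [|p s IH] sI; first by rewrite big_nil.
  rewrite big_cons; apply: ID; last first.
    by apply: IH => q qs; apply: sI; rewrite inE qs orbT.
  have [Ip1 _] := sI p (mem_head _ _).
  by case: (IM p.2 p.1 Ip1).
exists [:: (e, x)]; first by move=> p; rewrite inE => /eqP ->.
by rewrite big_seq1; case: (eP x Ix).
Qed.

(** * The Morita context of a Peirce algebra *)

Section PeirceMorita.
Variables (R : comPzRingType) (P : peirceAlg R).

(** Differences of pure tensors generate everything, and a minus sign is absorbed into the left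
    factor. *)
Lemma comp_tensor_mul_sum i j k (t : comp_tensor P i j k) :
  exists s : seq (comp P i j * comp P j k),
    comp_tensor_mul t = \sum_(p <- s) cmul p.1 p.2.
Proof.
have cmulNl (x : comp P i j) (y : comp P j k) : cmul (- x) y = - cmul x y.
  have c0 : cmul 0 y = 0 :> comp P i k.
    by apply: (addrI (cmul 0 y)); rewrite -cmulDl !addr0.
  by apply: (addIr (cmul x y)); rewrite -cmulDl !addNr.
elim/tensor_ind: t => [|t u [s ts] [r ur]|x y]; last first.
- by exists [:: (x, y)]; rewrite big_seq1 comp_tensor_mul_tens.
- exists (s ++ [seq (- p.1, p.2) | p <- r]).
  rewrite comp_tensor_mulB ts ur big_cat big_map -sumrN; congr (_ + _).
  by apply: eq_bigr => p _; rewrite cmulNl.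
- by exists [::]; rewrite big_nil -[0]subr0 comp_tensor_mulB subrr.
Qed.

Variables (d : nat) (hd : strongly_unital P d).

Definition colB : bimodule (diag_ring hd) (deg0_ring P) :=
  @Bimodule (diag_ring hd) (deg0_ring P) (comp P d 0)
    (@cmul _ P d d 0) (@cmul _ P d 0 0)
    (@cmulDl _ P d 0 0) (@cmulDr _ P d 0 0) (@cmulA _ P d 0 0 0)
    (@cmul1 _ P d) (@cmulA _ P d d 0 0).

(** The right unit law over A_d is one half of strong unitality. *)
Definition rowB : bimodule (deg0_ring P) (diag_ring hd) :=
  @Bimodule (deg0_ring P) (diag_ring hd) (comp P 0 d)
    (@cmul _ P 0 0 d) (@cmul _ P 0 d d)
    (@cmulDl _ P 0 d d) (@cmulDr _ P 0 d d) (@cmulA _ P 0 d d d)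
    (@cmul_sunit _ _ _ hd) (@cmulA _ P 0 0 d d).

Lemma peirce_morita (z : Zideal P d 1) :
  equivalent_categories (lmod_category (diag_ring hd))
                        (lmod_category (deg0_ring P)).
Proof.
(* [s] expresses 1 in A, and [r] below expresses the identity of A_d, reached because the product
   map onto A_d is bijective. *)
have [t _ t1] := z; have [s s1] := comp_tensor_mul_sum t.
have [g _ gK] := comp_tensor_iso P d.
have [r r1] := comp_tensor_mul_sum (g (sunit hd)).
exists (hom_functor colB), (hom_functor rowB); split; constructor.
- apply: (@morita_nat_iso _ _ colB rowB (@cmul _ P d 0 d) (@cmul _ P 0 d 0)
    _ _ _ _ _ _ _ r); last by rewrite -r1 gK.
  + exact: cmulDl.
  + exact: cmulDr.
  + by move=> *; rewrite [RHS]cmulA.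
  + by move=> *; rewrite [LHS]cmulA.
  + by move=> *; rewrite [LHS]cmulA.
  + by move=> *; rewrite [RHS]cmulA.
  + by move=> *; rewrite [RHS]cmulA.
- apply: (@morita_nat_iso _ _ rowB colB (@cmul _ P 0 d 0) (@cmul _ P d 0 d)
    _ _ _ _ _ _ _ s); last by rewrite -s1.
  + exact: cmulDl.
  + exact: cmulDr.
  + by move=> *; rewrite [RHS]cmulA.
  + by move=> *; rewrite [LHS]cmulA.
  + by move=> *; rewrite [LHS]cmulA.
  + by move=> *; rewrite [RHS]cmulA.
  + by move=> *; rewrite [RHS]cmulA.
Qed.

End PeirceMorita.

(* hZ0 is the convention that a unital ring is nonzero, applied to Zideal P d
   and only demanded when the degree zero ring is itself nonzero. *)
Theorem corollary3p2p2 (R : comPzRingType) (P : peirceAlg R) (d : nat)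
    (hd : strongly_unital P d)
    (hZ : unital_ideal (Zideal P d))
    (hZ0 : (exists a : deg0_ring P, a <> 0) -> exists2 z, Zideal P d z & z <> 0)
    (hA : no_nontrivial_idempotent_ideals (deg0_ring P)) :
  equivalent_categories (lmod_category (diag_ring hd))
                        (lmod_category (deg0_ring P)).
Proof.
apply: peirce_morita.
case: (hA _ (unital_ideal_idempotent (Zideal_ideal P d) hZ)) => ZE; last first.
  by rewrite ZE.
(* When Z_d = 0, the goal becomes 1 = 0 in A; otherwise A is nonzero and [hZ0] yields a nonzero
   element of Z_d. *)
rewrite ZE /=; apply: contrapT => n10.
have [z] := hZ0 (ex_intro _ 1 n10).
by rewrite ZE.
Qed.
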